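(* Let $2\le k<\omega$ and let $T$ be a complete first-order theory. (i) If $T$ has $k$-DCTP$_2$, then $T$ has TP$_2$. (ii) If $T$ has $k$-DCTP$_2$, then $T$ has SOP$_1$. (iii) If $T$ has ATP, then $T$ has $k$-DCTP$_2$. (iv) If $T$ has $k$-DCTP$_2$, then $T$ has $(k+1)$-DCTP$_2$.
   Context: Parameters are taken in a monster model of $T$. A theory has one of the properties below if some formula $\varphi(x,y)$ has it. On $2^{<\omega}$: $\eta\wedge\nu$ is the longest common initial segment; $\eta\perp\nu$ means incomparable under $\subseteq$; $\eta<_{lex}\nu$ if $\eta\subsetneq\nu$, or $\eta\perp\nu$ and $\eta(l)<\nu(l)$ at the first place $l$ where they differ; an antichain is a set of pairwise incomparable elements; ${}^\frown$ is concatenation. A set of formulas is $k$-inconsistent if every subset of size $k$ is inconsistent. $k$-DCTP$_2$: An antichain $\{\eta_0,\dots,\eta_n\}\subseteq 2^{<\omega}$ with $\eta_0<_{lex}\cdots<_{lex}\eta_n$ is a descending comb if $\eta_i\wedge\eta_k=\eta_j\wedge\eta_k$ for all $i<j<k\le n$. $\varphi(x,y)$ has $k$-DCTP$_2$ if there is $(a_\eta)_{\eta\in2^{<\omega}}$ such that $\{\varphi(x,a_\eta)\}_{\eta\in X}$ is consistent for each descending comb $X\subseteq 2^{<\omega}$, and $\{\varphi(x,a_{\eta|_i})\}_{i<\omega}$ is $k$-inconsistent for each $\eta\in2^\omega$. TP$_2$: there is $(a_{i,j})_{i,j\in\omega}$ such that $\{\varphi(x,a_{n,\eta(n)})\}_{n\in\omega}$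 is consistent for all $\eta\in\omega^\omega$, and $\{\varphi(x,a_{i,j}),\varphi(x,a_{i,l})\}$ is inconsistent for all $i,j,l$ with $j\ne l$. SOP$_1$: there is $(a_\eta)_{\eta\in2^{<\omega}}$ such that $\{\varphi(x,a_{\eta|_n})\}_{n\in\omega}$ is consistent for all $\eta\in2^\omega$, and $\{\varphi(x,a_{\eta^\frown 1}),\varphi(x,a_{\eta^\frown 0^\frown\nu})\}$ is inconsistent for all $\eta,\nu\in2^{<\omega}$. ATP: there is $(a_\eta)_{\eta\in2^{<\omega}}$ such that $\{\varphi(x,a_\eta)\}_{\eta\in X}$ is consistent for every antichain $X\subseteq2^{<\omega}$, and $\{\varphi(x,a_\eta),\varphi(x,a_\nu)\}$ is inconsistent whenever $\eta\subsetneq\nu$. *)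

(* Defs.v *)
(* Library: MathComp, with the classical layer of MathComp-Analysis for sets
   and cardinalities. *)
From mathcomp Require Import all_boot.
From mathcomp Require Import boolp classical_sets functions cardinality.

Set Implicit Arguments.
Unset Strict Implicit.
Unset Printing Implicit Defensive.

Local Open Scope classical_set_scope.
Local Open Scope card_scope.

(** * First-order logic *)

Record language := Language {
  fun_sym : Type;
  fun_arity : fun_sym -> nat;
  rel_sym : Type;
  rel_arity : rel_sym -> nat }.

(* Terms and formulas are indexed by the type [V] of their free variables;
   a quantifier binds the new variable [None : option V]. *)
Inductive term (L : language) (V : Type) : Type :=
| Var of V
| App (f : fun_sym L) of ('I_(fun_arity f) -> term L V).

Inductive formula (L : language) (V : Type) : Type :=
| Falsum
| Equal of term L V & term L V
| Rel (r : rel_sym L) of ('I_(rel_arity r) -> term L V)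
| Imp of formula L V & formula L V
| Forall of formula L (option V).

Arguments Falsum {L V}.

Definition Neg L V (phi : formula L V) : formula L V := Imp phi Falsum.

Definition sentence (L : language) : Type := formula L void.

Record structure (L : language) := Structure {
  carrier :> Type;
  carrier_inhabited : inhabited carrier;
  fun_interp (f : fun_sym L) : ('I_(fun_arity f) -> carrier) -> carrier;
  rel_interp (r : rel_sym L) : ('I_(rel_arity r) -> carrier) -> Prop }.

Definition env_cons V X (x : X) (e : V -> X) : option V -> X :=
  fun v => if v is Some w then e w else x.

Definition env_sum V W X (e : V -> X) (d : W -> X) : V + W -> X :=
  fun v => match v with inl i => e i | inr j => d j end.

Fixpoint eval L (M : structure L) V (e : V -> M) (t : term L V) : M :=
  match t with
  | Var v => e v
  | App f args => fun_interp (fun i => eval e (args i))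
  end.

Fixpoint sat L (M : structure L) V (e : V -> M) (phi : formula L V) : Prop :=
  match phi with
  | Falsum => False
  | Equal t u => eval e t = eval e u
  | Rel r args => rel_interp (fun i => eval e (args i))
  | Imp phi1 phi2 => sat e phi1 -> sat e phi2
  | Forall phi1 => forall x : M, sat (env_cons x e) phi1
  end.

Definition holds L (M : structure L) (s : sentence L) : Prop :=
  sat (fun v : void => match v return M with end) s.

Definition model L (T : set (sentence L)) (M : structure L) : Prop :=
  forall s, T s -> holds M s.

Definition entails L (T : set (sentence L)) (s : sentence L) : Prop :=
  forall M : structure L, model T M -> holds M s.

Definition complete_theory L (T : set (sentence L)) : Prop :=
  (exists M : structure L, model T M) /\
  (forall s, entails T s \/ entails T (Neg s)).

(** * Monster models *)

Definition elementary_embedding L (M N : structure L) (f : M -> N) : Prop :=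
  forall n (phi : formula L 'I_n) (e : 'I_n -> M),
    sat e phi <-> sat (f \o e) phi.

Definition partial_elementary L (M : structure L) (A : set M) (f : M -> M) :
    Prop :=
  forall n (phi : formula L 'I_n) (e : 'I_n -> M),
    (forall i, A (e i)) -> (sat e phi <-> sat (f \o e) phi).

Definition automorphism L (M : structure L) (g : M -> M) : Prop :=
  [/\ bijective g,
      forall (f : fun_sym L) args,
        g (fun_interp args) = fun_interp (f := f) (g \o args)
    & forall (r : rel_sym L) args,
        rel_interp args <-> rel_interp (r := r) (g \o args)].

(* The cardinal kappa is represented by a type [K] of that cardinality. *)
Definition card_lt X (A : set X) (K : Type) : Prop :=
  (A #<= [set: K]) /\ ~ ([set: K] #<= A).

(* A formula over [A] in [n] variables is a formula whose free variables are
   the [n] variables and names for the elements of [A]. *)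
Definition saturated L (K : Type) (M : structure L) : Prop :=
  forall A : set M, card_lt A K ->
  forall n (Sigma : set (formula L ('I_n + {x : M | A x}))),
    (forall F, finite_set F -> F `<=` Sigma ->
       exists c : 'I_n -> M, forall phi, F phi -> sat (env_sum c sval) phi) ->
    exists c : 'I_n -> M, forall phi, Sigma phi -> sat (env_sum c sval) phi.

Definition strongly_homogeneous L (K : Type) (M : structure L) : Prop :=
  forall A : set M, card_lt A K ->
  forall f : M -> M, partial_elementary A f ->
    exists2 g : M -> M, automorphism g & forall x, A x -> g x = f x.

(* [formula L nat] has cardinality |L| + aleph_0. *)
Definition monster L (K : Type) (T : set (sentence L)) (M : structure L) :
    Prop :=
  [/\ model T M, card_lt [set: formula L nat] K, saturated K M
    & strongly_homogeneous K M].

(* [consistent phi B]: the set {phi(x, b) | b in B} is consistent with the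
   elementary diagram of M, that is, realized in an elementary extension of
   M.  The variables x and y of phi(x, y) are tuples of lengths p and q. *)
Definition consistent L (M : structure L) p q (phi : formula L ('I_p + 'I_q))
    (B : set ('I_q -> M)) : Prop :=
  exists (N : structure L) (f : M -> N) (c : 'I_p -> N),
    elementary_embedding f /\ forall b, B b -> sat (env_sum c (f \o b)) phi.

(* k-inconsistency refers to the family and not to its set of values: any k
   distinct indices, even with equal parameters, give an inconsistent set.
   If repetitions were ignored, constant families would be k-inconsistent for
   every k >= 2. *)
Definition k_inconsistent (k : nat) L (M : structure L) p q
    (phi : formula L ('I_p + 'I_q)) (b : nat -> 'I_q -> M) : Prop :=
  forall s : seq nat, uniq s -> size s = k ->
    ~ consistent phi (b @` [set` s]).

(** * The tree 2^{<omega} *)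

(* Nodes are lists of booleans, the root is [::], the i-th entry of the list
   is the value at i, and [mkseq eta i] is the restriction to i of
   eta : nat -> bool. *)
Definition node := seq bool.

Definition incomparable (eta nu : node) : bool :=
  ~~ prefix eta nu && ~~ prefix nu eta.

Fixpoint meet (eta nu : node) : node :=
  match eta, nu with
  | a :: eta', b :: nu' => if a == b then a :: meet eta' nu' else [::]
  | _, _ => [::]
  end.

(* Incomparable nodes first differ at the place [size (meet eta nu)]. *)
Definition lex_lt (eta nu : node) : bool :=
  (prefix eta nu && (eta != nu)) ||
  (incomparable eta nu &&
   (nth false eta (size (meet eta nu)) < nth false nu (size (meet eta nu)))).

Definition antichain (X : set node) : Prop :=
  forall eta nu, X eta -> X nu -> eta <> nu -> incomparable eta nu.

Definition descending_comb (X : set node) : Prop :=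
  exists (n : nat) (eta : 'I_n.+1 -> node),
    [/\ X = range eta, antichain X,
        forall i j : 'I_n.+1, i < j -> lex_lt (eta i) (eta j)
      & forall i j k : 'I_n.+1, i < j -> j < k ->
          meet (eta i) (eta k) = meet (eta j) (eta k)].

(** * The dividing lines, for a formula with parameters in M *)

Section Properties.
Variables (L : language) (M : structure L).

Definition DCTP2 (k : nat) p q (phi : formula L ('I_p + 'I_q)) : Prop :=
  exists a : node -> 'I_q -> M,
    (forall X, descending_comb X -> consistent phi (a @` X)) /\
    (forall eta : nat -> bool, k_inconsistent k phi (fun i => a (mkseq eta i))).

Definition TP2 p q (phi : formula L ('I_p + 'I_q)) : Prop :=
  exists a : nat -> nat -> 'I_q -> M,
    (forall eta : nat -> nat, consistent phi (range (fun n => a n (eta n)))) /\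
    (forall i j l, j <> l -> ~ consistent phi [set a i j; a i l]).

Definition SOP1 p q (phi : formula L ('I_p + 'I_q)) : Prop :=
  exists a : node -> 'I_q -> M,
    (forall eta : nat -> bool,
       consistent phi (range (fun n => a (mkseq eta n)))) /\
    (forall eta nu : node,
       ~ consistent phi [set a (rcons eta true); a (rcons eta false ++ nu)]).

Definition ATP p q (phi : formula L ('I_p + 'I_q)) : Prop :=
  exists a : node -> 'I_q -> M,
    (forall X, antichain X -> consistent phi (a @` X)) /\
    (forall eta nu : node, prefix eta nu -> eta <> nu ->
       ~ consistent phi [set a eta; a nu]).

(* A theory with monster model M has a property if some formula has it. *)
Definition some_formula
    (P : forall p q, formula L ('I_p + 'I_q) -> Prop) : Prop :=
  exists (p q : nat) (phi : formula L ('I_p + 'I_q)), P p q phi.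

Definition has_DCTP2 (k : nat) : Prop := some_formula (DCTP2 k).
Definition has_TP2 : Prop := some_formula TP2.
Definition has_SOP1 : Prop := some_formula SOP1.
Definition has_ATP : Prop := some_formula ATP.

End Properties.

(* Main.v *)
Require Import Defs.
From mathcomp Require Import all_boot zify.
From mathcomp Require Import boolp classical_sets functions cardinality.

Set Implicit Arguments.
Unset Strict Implicit.
Unset Printing Implicit Defensive.

(** ATP gives k-DCTP2 with the same tree, since descending combs are
    antichains and two nodes of a path are comparable; and k-inconsistency
    implies (k+1)-inconsistency. The content is in the two other implications.

    A descending comb consists of teeth that branch off to the right from a
    spine which keeps to their left. If k = 2, k-DCTP2 therefore contains the
    two other properties explicitly. For TP2, put the node 0^i 1 0^j in the
    cell (i, j): a row lies on a path and a vertical path is a comb. For SOP1,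
    let the node x stand for the instance at x 1: the nodes of a path from
    which it goes on to the left yield a comb, and those from which it goes on
    to the right yield comparable nodes. It is then enough to arrange a tree
    such that both children of a node, and all that follows them, are on the
    left side above it, while the child 0, with all that follows, is on the
    right side above the child 1; the map that replaces each 1 by 0 and each 0
    by 01 does this.

    For larger k, these constructions only give k-inconsistent rows and
    chains. To reach inconsistent pairs, the formula is replaced by a
    conjunction of instances that share as many members of a row or of a chain
    as consistency permits: as this number is maximal, adding one more
    instance to each row of a group of rows (for TP2, [array_blocks]),
    respectively to the chain (for SOP1, [tree_blocks]), is inconsistent with
    sufficiently many other instances, and two conjunctions that should
    exclude each other do contain so many. That inconsistency occurs
    everywhere, not just somewhere, comes from a Ramsey theorem for chains of
    the binary tree, [tree_ramsey], proved by fusion.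

    These arguments yield arbitrarily large finite arrays and trees for one
    conjunction. The saturation of M turns them into infinite ones
    ([realized_compactness]) and makes infinite sets of instances consistent
    as soon as their finite subsets are realized in M ([realized_range]). *)

Local Open Scope classical_set_scope.

(** * Renaming, quantifying and supporting variables *)

Section Syntax.
Variable L : language.

Fixpoint rename_term V W (g : V -> W) (t : term L V) : term L W :=
  match t with
  | Var v => Var L (g v)
  | App f args => App (fun i => rename_term g (args i))
  end.

Fixpoint rename V W (g : V -> W) (phi : formula L V) : formula L W :=
  match phi with
  | Falsum => Falsum
  | Equal t u => Equal (rename_term g t) (rename_term g u)
  | Rel r args => Rel (fun i => rename_term g (args i))
  | Imp phi1 phi2 => Imp (rename g phi1) (rename g phi2)
  | Forall phi1 => Forall (rename (option_map g) phi1)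
  end.

Definition Exists V (phi : formula L (option V)) : formula L V :=
  Neg (Forall (Neg phi)).

Definition And V (phi psi : formula L V) : formula L V :=
  Neg (Imp phi (Neg psi)).

Definition Conj V (s : seq (formula L V)) : formula L V :=
  foldr (@And V) (Neg Falsum) s.

Lemma eval_rename V W (g : V -> W) (M : structure L) (e : W -> M) t :
  eval e (rename_term g t) = eval (e \o g) t.
Proof. by elim: t => //= f args IH; congr fun_interp; apply/funext. Qed.

Lemma sat_rename V W (g : V -> W) (M : structure L) (e : W -> M) phi :
  sat e (rename g phi) <-> sat (e \o g) phi.
Proof.
elim: phi W g e => {V} [V|V t u|V r args|V phi1 IH1 phi2 IH2|V phi IH] W g e /=.
- by [].
- by rewrite !eval_rename.
- by under eq_fun do rewrite eval_rename.
- by rewrite IH1 IH2.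
- have E x : env_cons x e \o option_map g = env_cons x (e \o g).
    by apply/funext; case.
  by split=> H x; have := H x; rewrite IH E.
Qed.

Lemma sat_Exists V (M : structure L) (e : V -> M) phi :
  sat e (Exists phi) <-> exists x, sat (env_cons x e) phi.
Proof.
split=> [/= /existsNP[x /contrapT H]|[x H]]; first by exists x.
by move=> /= /(_ x).
Qed.

Lemma sat_And V (M : structure L) (e : V -> M) phi psi :
  sat e (And phi psi) <-> sat e phi /\ sat e psi.
Proof.
split=> [/=|[H1 H2] /= /(_ H1 H2)//].
by move=> H; split; apply: contrapT => H'; apply: H.
Qed.

Lemma sat_Conj V (M : structure L) (e : V -> M) (I : eqType) (s : seq I)
    (theta : I -> formula L V) :
  sat e (Conj [seq theta i | i <- s]) <->
  (forall i, i \in s -> sat e (theta i)).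
Proof.
elim: s => [|i s IH]; first by split=> // _ [].
rewrite sat_And IH; split=> [[Hi Hs] j|H].
  by rewrite inE => /predU1P[->|/Hs].
by split=> [|j js]; apply: H; rewrite inE ?eqxx ?js ?orbT.
Qed.

(** The quantified variables are moved one at a time from ['I_n] to the bound
    variable [None]; [psi] does not depend on the structure, so that it can be
    carried along an elementary embedding. *)
Lemma exists_tuple n V (phi : formula L (V + 'I_n)) :
  exists psi : formula L V, forall (M : structure L) (e : V -> M),
    sat e psi <-> exists d : 'I_n -> M, sat (env_sum e d) phi.
Proof.
elim: n V phi => [|n IH] V phi.
  pose g (v : V + 'I_0) : V :=
    match v with inl w => w | inr i => False_rect V (notF (ltn_ord i)) end.
  exists (rename g phi) => M e; rewrite sat_rename.
  have E d : env_sum e d = e \o g by apply/funext => -[//|[]].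
  split=> [H|[d]]; last by rewrite E.
  by exists (fun i : 'I_0 => False_rect M (notF (ltn_ord i))); rewrite E.
pose g (v : V + 'I_n.+1) : option V + 'I_n :=
  match v with
  | inl w => inl (Some w)
  | inr i => if unlift ord0 i is Some j then inr j else inl None
  end.
have [psi Hpsi] := IH _ (rename g phi).
exists (Exists psi) => M e; rewrite sat_Exists; split.
  case=> x /Hpsi[d]; rewrite sat_rename => H.
  exists (fun i => if unlift ord0 i is Some j then d j else x).
  suff <- : env_sum (env_cons x e) d \o g =
    env_sum e (fun i => if unlift ord0 i is Some j then d j else x) by [].
  by apply/funext => -[//|i] /=; case: unliftP.
case=> d H; exists (d ord0); apply/Hpsi; exists (d \o lift ord0).
rewrite sat_rename.
suff -> : env_sum (env_cons (d ord0) e) (d \o lift ord0) \o g = env_sum e d.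
  by [].
by apply/funext => -[//|i] /=; case: unliftP => [j|] ->.
Qed.

Lemma term_support V (t : term L V) :
  exists2 A : set V, finite_set A &
    forall (M : structure L) (e e' : V -> M),
      (forall v, A v -> e v = e' v) -> eval e t = eval e' t.
Proof.
elim: t => [v|f args IH].
  by exists [set v]; [exact: finite_set1|move=> M e e'; apply].
have [//|A HA] := @choice _ _ (fun i B => finite_set B /\
    forall (M : structure L) (e e' : V -> M),
    (forall v, B v -> e v = e' v) -> eval e (args i) = eval e' (args i)).
  by move=> i; have [B] := IH i; exists B.
exists (\bigcup_(i in [set: 'I_(fun_arity f)]) A i).
  by apply: bigcup_finite => [|i _]; [exact: finite_finset|case: (HA i)].
move=> M e e' H /=; congr fun_interp; apply/funext => i.
by apply: (HA i).2 => v Av; apply: H; exists i.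
Qed.

Lemma formula_support V (phi : formula L V) :
  exists2 A : set V, finite_set A &
    forall (M : structure L) (e e' : V -> M),
      (forall v, A v -> e v = e' v) -> sat e phi <-> sat e' phi.
Proof.
elim: phi => {V} [V|V t u|V r args|V phi1 [A1 fin1 H1] phi2 [A2 fin2 H2]
  |V phi [A fin H]].
- by exists set0; first exact: finite_set0.
- have [A1 fin1 H1] := term_support t; have [A2 fin2 H2] := term_support u.
  exists (A1 `|` A2); first by rewrite finite_setU.
  move=> M e e' He /=.
  by rewrite (H1 M e e') 1?(H2 M e e') // => v Av; apply: He; [right|left].
- have [//|A HA] := @choice _ _ (fun i B => finite_set B /\
      forall (M : structure L) (e e' : V -> M),
      (forall v, B v -> e v = e' v) -> eval e (args i) = eval e' (args i)).
    by move=> i; have [B] := term_support (args i); exists B.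
  exists (\bigcup_(i in [set: 'I_(rel_arity r)]) A i).
    by apply: bigcup_finite => [|i _]; [exact: finite_finset|case: (HA i)].
  move=> M e e' He /=.
  have -> // : (fun i => eval e (args i)) = (fun i => eval e' (args i)).
  apply/funext => i; apply: (HA i).2 => v Av; apply: He; by exists i.
- exists (A1 `|` A2); first by rewrite finite_setU.
  move=> M e e' He /=.
  by rewrite (H1 M e e') 1?(H2 M e e') // => v Av; apply: He; [right|left].
- exists (Some @^-1` A); first by apply: finite_preimage => // x y _ _ [].
  move=> M e e' He /=.
  have E x : sat (env_cons x e) phi <-> sat (env_cons x e') phi.
    by apply: H => -[v Av|//]; exact: He.
  by split=> S x; apply/E.
Qed.

End Syntax.

(** * Realizing finite and countable families of instances *)

Section Realized.
Variables (L : language) (p q : nat) (phi : formula L ('I_p + 'I_q)).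

(** A solution in [M] itself is asked for, whereas [consistent] asks for one
    in an elementary extension. *)
Definition realized (M : structure L) (I : eqType) (a : I -> 'I_q -> M)
    (s : seq I) : Prop :=
  exists c : 'I_p -> M, forall i, i \in s -> sat (env_sum c (a i)) phi.

Lemma realized_sub (M : structure L) (I : eqType) (a : I -> 'I_q -> M)
    (s s' : seq I) :
  {subset s' <= s} -> realized a s -> realized a s'.
Proof. by move=> ss' [c Hc]; exists c => i /ss' /Hc. Qed.

Lemma exists_common (I : finType) :
  exists psi : formula L (I * 'I_q), forall (M : structure L) e,
    sat e psi <-> realized (fun i j => e (i, j) : M) (enum I).
Proof.
pose g (i : I) (v : 'I_p + 'I_q) : (I * 'I_q) + 'I_p :=
  match v with inl l => inr l | inr j => inl (i, j) end.
have [psi Hpsi] := exists_tuple (Conj [seq rename (g i) phi | i <- enum I]).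
exists psi => M e; rewrite Hpsi.
have E c i : env_sum e c \o g i = env_sum c (fun j => e (i, j)).
  by apply/funext => -[].
split=> -[c Hc]; exists c.
  by move/sat_Conj: Hc => Hc i /Hc; rewrite sat_rename E.
by apply/sat_Conj => i /Hc; rewrite sat_rename E.
Qed.

Lemma exists_common_seq (V : Type) (I : eqType) (g : I -> 'I_q -> V)
    (s : seq I) :
  exists psi : formula L V, forall (M : structure L) e,
    sat e psi <-> realized (fun i j => e (g i j) : M) s.
Proof.
have [psi Hpsi] := exists_common 'I_(size s).
exists (rename (fun ij => g (tnth (in_tuple s) ij.1) ij.2) psi) => M e.
rewrite sat_rename Hpsi; split=> -[c Hc]; exists c => i.
  by move/(tnthP (in_tuple s)) => [j ->]; exact: (Hc j (mem_enum _ j)).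
move=> _; apply: (Hc (tnth (in_tuple s) i)).
exact: (mem_tnth i (in_tuple s)).
Qed.

(** A realization in an elementary extension is pulled back to [M]: that
    finitely many instances have a common solution is a first-order condition
    on their parameters. *)
Lemma consistent_realized (M : structure L) (I : eqType) (a : I -> 'I_q -> M)
    (s : seq I) (B : set ('I_q -> M)) :
  consistent phi B -> (forall i, i \in s -> B (a i)) -> realized a s.
Proof.
case=> N [f [c [fE Hc]]] sB.
have [psi Hpsi] := exists_common 'I_(size s).
pose e (ij : 'I_(size s) * 'I_q) := a (tnth (in_tuple s) ij.1) ij.2.
have : sat (f \o (e \o enum_val)) (rename enum_rank psi).
  rewrite sat_rename.
  have -> : f \o (e \o enum_val) \o enum_rank = f \o e.
    by apply/funext => x /=; rewrite enum_rankK.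
  apply/Hpsi; exists c => i _; apply: (Hc (a (tnth (in_tuple s) i))); apply: sB.
  exact: (mem_tnth i (in_tuple s)).
rewrite -fE sat_rename.
have -> : (e \o enum_val) \o enum_rank = e.
  by apply/funext => x /=; rewrite enum_rankK.
rewrite Hpsi => -[d Hd]; exists d => i /(tnthP (in_tuple s)) [j ->].
exact: (Hd j (mem_enum _ j)).
Qed.

Lemma realized_consistent (M : structure L) (I : eqType) (a : I -> 'I_q -> M)
    (s : seq I) (B : set ('I_q -> M)) :
  realized a s -> B `<=` a @` [set` s] -> consistent phi B.
Proof.
case=> c Hc sB; exists M, id, c; split=> // b /sB[i si <-].
exact: Hc.
Qed.

(** Packs [n] parameter tuples into one, [B] being the packing, so that blocks
    of instances of [phi] become single instances of a formula [psi]. *)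
Lemma conj_formula (n : nat) :
  exists (q' : nat) (psi : formula L ('I_p + 'I_q')),
  forall M : structure L, exists B : ('I_n -> 'I_q -> M) -> 'I_q' -> M,
  forall (c : 'I_p -> M) t,
    sat (env_sum c (B t)) psi <-> forall i, sat (env_sum c (t i)) phi.
Proof.
pose X := ('I_n * 'I_q)%type.
pose g (i : 'I_n) (v : 'I_p + 'I_q) : 'I_p + 'I_#|{: X}| :=
  match v with inl l => inl l | inr j => inr (enum_rank (i, j)) end.
exists #|{: X}|, (Conj [seq rename (g i) phi | i <- enum 'I_n]) => M.
exists (fun t z => t (enum_val z).1 (enum_val z).2) => c t.
rewrite sat_Conj.
set B := (fun z : 'I_#|{: X}| => t _ _).
have E i : env_sum c B \o g i = env_sum c (t i).
  by apply/funext => -[//|j]; rewrite /= /B enum_rankK.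
split=> H i; first by have := H i (mem_enum _ i); rewrite sat_rename E.
by move=> _; rewrite sat_rename E.
Qed.

End Realized.

(** * Compactness inside a saturated model *)

Section Saturation.
Variables (L : language) (K : Type) (M : structure L).
Hypothesis hK : card_lt [set: formula L nat] K.
Hypothesis hS : saturated K M.

Lemma nat_le_formula : ([set: nat] #<= [set: formula L nat])%card.
Proof.
pose g (phi : formula L nat) :=
  match phi with Equal (Var i) _ => i | _ => 0 end.
apply: card_le_trans (card_image_le g [set: formula L nat]).
by apply: subset_card_le => i _; exists (Equal (Var L i) (Var L i)).
Qed.

(** Countable sets of parameters are small, as there are infinitely many
    formulas and fewer formulas than elements of [K]. *)
Lemma countable_card_lt (A : set M) : countable A -> card_lt A K.
Proof.
move=> cA; have AF := card_le_trans cA nat_le_formula.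
case: hK => FK KF; split; first exact: card_le_trans FK.
by move=> KA; apply: KF; exact: card_le_trans AF.
Qed.

Lemma saturated_countable n (W : countType) (b : W -> M)
    (theta : nat -> formula L ('I_n + W)) :
  (forall N, exists c, forall i, i < N -> sat (env_sum c b) (theta i)) ->
  exists c, forall i, sat (env_sum c b) (theta i).
Proof.
move=> Hfin; pose A := range b.
have cA : card_lt A K.
  apply: countable_card_lt.
  exact: card_le_trans (card_image_le _ _) (countableP _).
pose g (v : 'I_n + W) : 'I_n + {x : M | A x} :=
  match v with
  | inl i => inl i
  | inr w => inr (exist A (b w) (ex_intro2 _ _ w I erefl))
  end.
have E c : env_sum c sval \o g = env_sum c b by apply/funext => -[].
have [|c Hc] := hS cA (Sigma := range (fun i => rename g (theta i))).
  move=> F finF FS.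
  have [|h Hh] := @choice _ _ (fun psi i => F psi -> rename g (theta i) = psi).
    move=> psi; have [/FS[i _ <-]|nF] := pselect (F psi); first by exists i.
    by exists 0.
  have /finite_seqP[s Es] := finite_image h finF.
  have [c Hc] := Hfin (\max_(i <- s) i).+1; exists c => psi Fpsi.
  rewrite -(Hh _ Fpsi) sat_rename E; apply: Hc; rewrite ltnS.
  have hs : h psi \in s.
    by have : [set` s] (h psi) by rewrite -Es; exists psi.
  by rewrite (big_rem _ hs) leq_maxl.
exists c => i; rewrite -E -sat_rename; apply: Hc; by exists i.
Qed.

(** Saturation realizes types in finitely many variables only, so the values
    of the countably many variables are chosen one after the other. The
    invariant [extendible m e] says that, for each [N], the values of [e]
    below [m] extend to a solution of the first [N] formulas; the next value
    has to realize a type over the values already chosen, because the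
    existence of the remaining values is first-order (only finitely many
    variables occur). *)
Lemma compactness (theta : nat -> formula L nat) :
  (forall N, exists e : nat -> M, forall i, i < N -> sat e (theta i)) ->
  exists e : nat -> M, forall i, sat e (theta i).
Proof.
move=> Hfin.
pose extendible m (e : nat -> M) := forall N, exists2 e' : nat -> M,
  (forall i, i < m -> e' i = e i) & forall i, i < N -> sat e' (theta i).
have step m e : extendible m e ->
    exists2 e' : nat -> M, (forall i, i < m -> e' i = e i) &
      extendible m.+1 e'.
  move=> He; pose b (i : 'I_m) := e i.
  have H N : exists psi : formula L ('I_1 + 'I_m), forall c : 'I_1 -> M,
      sat (env_sum c b) psi <-> exists e', [/\ forall i, i < m -> e' i = e i,
        e' m = c ord0 & forall i, i < N -> sat e' (theta i)].
    pose Phi := Conj [seq theta i | i <- iota 0 N].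
    have [A Afin HA] := formula_support Phi.
    have /finite_seqP[s Es] := Afin; pose B := \max_(i <- s) i.
    have AB v : A v -> v <= B.
      rewrite Es => /= vs; by rewrite /B (big_rem _ vs) leq_maxl.
    (* Variables below m are parameters, the variable m is new, and those
       between m and the bound B get quantified. *)
    pose g (i : nat) : ('I_1 + 'I_m) + 'I_B.+1 :=
      if insub i is Some j then inl (inr j) else
      if i == m then inl (inl ord0) else inr (inord i).
    have [psi Hpsi] := exists_tuple (rename g Phi).
    exists psi => c; rewrite Hpsi; split.
      case=> d; rewrite sat_rename => Hd.
      exists (env_sum (env_sum c b) d \o g); split.
      - by move=> i im /=; rewrite /g insubT.
      - by rewrite /= /g insubF ?ltnn // eqxx.
      - by move=> i iN; move/sat_Conj: Hd; apply; rewrite mem_iota.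
    case=> e' [e'e e'm e'N]; exists (fun j => e' j); rewrite sat_rename.
    rewrite (HA _ _ e').
      by apply/sat_Conj => i; rewrite mem_iota; apply: e'N.
    move=> v /AB vB; rewrite /= /g; case: insubP => [j jm <- /=|_].
      by rewrite /b e'e.
    by case: eqP => [->//|_ /=]; rewrite inordK.
  have [psi Hpsi] := choice H.
  have [|c Hc] := @saturated_countable 1 'I_m b psi.
    move=> N.
    have [e' e'e e'N] := He (\max_(i < N) i).+1.
    exists (fun=> e' m) => i iN; apply/Hpsi; exists e'; split=> // j ji.
    apply: e'N; rewrite ltnS; apply: leq_trans (ltnW ji) _.
    exact: (leq_bigmax (Ordinal iN)).
  exists (fun i => if i == m then c ord0 else e i).
    by move=> i im; rewrite ltn_eqF.
  move=> N; have /Hpsi[e' [e'e e'm e'N]] := Hc N; exists e' => // i.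
  by rewrite ltnS leq_eqVlt; case: eqP => [->|_ /e'e].
have [e0 _] := Hfin 0.
(* The sequence of approximations freezes the value at i from stage i + 1 on. *)
pose X := {me : nat * (nat -> M) | extendible me.1 me.2}.
pose R (x y : X) := (sval y).1 = (sval x).1.+1 /\
  forall i, i < (sval x).1 -> (sval y).2 i = (sval x).2 i.
have RX x : {y | R x y}.
  apply: cid; case: x => -[m e] /= He; have [e' e'e He'] := step _ _ He.
  by exists (exist _ (m.+1, e') He').
have x0P : extendible 0 e0 by move=> N; have [e He] := Hfin N; exists e.
have [F [F0 FS]] := dependent_choice RX (exist _ (0, e0) x0P : X).
have Fm m : (sval (F m)).1 = m.
  by elim: m => [|m IH]; [rewrite F0|rewrite (FS m).1 IH].
have Fmn m n i : i < m -> m <= n -> (sval (F n)).2 i = (sval (F m)).2 i.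
  move=> im /subnKC <-; elim: (n - m) => [|d IH]; first by rewrite addn0.
  by rewrite addnS (FS _).2 // Fm (leq_trans im) ?leq_addr.
pose e i := (sval (F i.+1)).2 i.
exists e => k.
have [A Afin HA] := formula_support (theta k).
have /finite_seqP[s Es] := Afin; pose B := (\max_(i <- s) i).+1.
have AB v : A v -> v < B.
  by rewrite Es => /= vs; rewrite ltnS (big_rem _ vs) leq_maxl.
have := svalP (F B); rewrite Fm => /(_ k.+1)[e' e'e /(_ k (ltnSn k))].
rewrite (HA _ _ e) // => v /AB vB.
by rewrite e'e // /e (Fmn v.+1 B).
Qed.

(** Countably many instances involve a small set of parameters only, so by
    saturation a common solution exists already in [M]. *)
Lemma realized_range p q (phi : formula L ('I_p + 'I_q))
    (a : nat -> 'I_q -> M) :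
  (forall N, realized phi a (iota 0 N)) -> consistent phi (range a).
Proof.
move=> H.
pose g i (v : 'I_p + 'I_q) : 'I_p + (nat * 'I_q) :=
  match v with inl l => inl l | inr j => inr (i, j) end.
have E c i : env_sum c (fun ij => a ij.1 ij.2) \o g i = env_sum c (a i).
  by apply/funext => -[].
have [|c Hc] := @saturated_countable p (nat * 'I_q)%type
    (fun ij => a ij.1 ij.2) (fun i => rename (g i) phi).
  move=> N; have [c Hc] := H N; exists c => i iN.
  by rewrite sat_rename E; apply: Hc; rewrite mem_iota.
exists M, id, c; split=> // b [i _ <-].
by rewrite -E -sat_rename.
Qed.

(** That a pattern is realized, or not realized, is a first-order condition on
    the parameters at its indices. So this follows from [compactness], with
    the parameters coded by the variables [v i j]. *)
Lemma realized_compactness p q (phi : formula L ('I_p + 'I_q)) (I : countType)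
    (Pos Neg : set (seq I)) :
  (forall D : seq I, exists a : I -> 'I_q -> M,
     (forall s, Pos s -> {subset s <= D} -> realized phi a s) /\
     (forall s, Neg s -> {subset s <= D} -> ~ realized phi a s)) ->
  exists a : I -> 'I_q -> M,
    (forall s, Pos s -> realized phi a s) /\
    (forall s, Neg s -> ~ realized phi a s).
Proof.
move=> H; pose v (i : I) (j : 'I_q) : nat := pickle (i, j).
have [psi Hpsi] := choice (exists_common_seq phi v).
pose theta n : formula L nat := 
  if unpickle n is Some (b, s) then
    if `[< (if b then Pos else Neg) s >] then
      if b then psi s else Defs.Neg (psi s) else Defs.Neg Falsum
  else Defs.Neg Falsum.
have [|e He] := @compactness theta.
  move=> N.
  pose pattern n : seq I :=
    if (unpickle n : option (bool * seq I)) is Some (b, s) then s else [::].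
  have [a [aPos aNeg]] := H (flatten [seq pattern n | n <- iota 0 N]).
  have [e He] : exists e : nat -> M, forall i j, e (v i j) = a i j.
    have [x0] := carrier_inhabited M.
    exists (fun n => if unpickle n is Some (i, j) then a i j else x0) => i j.
    by rewrite pickleK.
  exists e => n nN; rewrite /theta.
  have E s : realized phi (fun i j => e (v i j)) s <-> realized phi a s.
    by under eq_fun do under eq_fun do rewrite He.
  have sub : {subset pattern n <= flatten [seq pattern n | n <- iota 0 N]}.
    move=> i si; apply/flattenP; exists (pattern n) => //.
    by apply: map_f; rewrite mem_iota.
  move: sub; rewrite /pattern; case: unpickle => [[b s] sub|_ //].
  case: asboolP => [Ps|_ /=]; last by []; case: b Ps => Ps /=.
    by apply/Hpsi/E; exact: aPos.
  by move=> /Hpsi/E; exact: aNeg.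
exists (fun i j => e (v i j)); split=> s Hs.
  have := He (pickle (true, s)); rewrite /theta pickleK.
  by rewrite (introT (asboolP _) Hs) Hpsi.
have := He (pickle (false, s)); rewrite /theta pickleK.
by rewrite (introT (asboolP _) Hs) /= Hpsi.
Qed.

End Saturation.

(** * A Ramsey theorem for chains of the binary tree *)

Section TreeRamsey.

Definition below b (x y : node) : bool := prefix (rcons x b) y.

Lemma below_rcons b x : below b x (rcons x b).
Proof. exact: prefix_refl. Qed.

Lemma below_trans b : transitive (below b).
Proof.
move=> y x z xy yz; apply: prefix_trans xy _.
exact: prefix_trans (prefix_rcons _ _) yz.
Qed.

Lemma below_nseq b i j : i < j -> below b (nseq i b) (nseq j b).
Proof.
move=> ij; rewrite /below -cats1 -[[:: b]]/(nseq 1 b) -nseqD addn1.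
by rewrite -(subnKC ij) nseqD prefix_prefix.
Qed.

(** Comparability, meets and the lexicographic order are thereby preserved,
    but levels need not be. *)
Definition embedding (f : node -> node) : Prop :=
  forall x b y, below b x y -> below b (f x) (f y).

(** The entry of [d] at [i] is the side on which the chain leaves its [i]-th
    node, so that a chain of type [d] has one more node than [d] has entries. *)
Fixpoint chain (d : seq bool) (l : seq node) : bool :=
  match l, d with
  | [:: x], [::] => true
  | x :: (y :: _) as l', b :: d' => below b x y && chain d' l'
  | _, _ => false
  end.

Arguments chain d l : simpl nomatch.

Lemma embedding_id : embedding id. Proof. by []. Qed.

Lemma embedding_comp f g : embedding f -> embedding g -> embedding (f \o g).
Proof. by move=> fE gE x b y /gE /fE. Qed.

Lemma embedding_cons b : embedding (cons b).
Proof. by move=> x d y xy; rewrite /below /= eqxx. Qed.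

Lemma embedding_cat z : embedding (cat z).
Proof. by move=> x d y xy; rewrite /below rcons_cat prefix_catr // eqxx. Qed.

Lemma chain_map f d l : embedding f -> chain d l -> chain d (map f l).
Proof.
move=> fE; elim: l d => [//|x [|y l] IH] [|b d] //= /andP[xy /IH H].
by rewrite fE.
Qed.

Lemma chain_cons b d x l : chain d ((b :: x) :: l) ->
  exists2 l', l = map (cons b) l' & chain d (x :: l').
Proof.
elim: l d x => [|y l IH] [|b' d] x //=; first by exists [::].
case: y => [//|b'' y]; rewrite /below => /andP[] /=.
case: eqP => //= <- xy /IH[l' -> H].
by exists (y :: l') => //=; rewrite /below xy.
Qed.

(** If the nodes of colour true are dense above some node [x], a copy of the
    tree is grown inside them from [x] upwards; otherwise some cone avoids
    them. *)
Lemma node_pigeonhole (c : node -> bool) :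
  exists2 f, embedding f & exists b, forall x, c (f x) = b.
Proof.
have [[x Hx]|/forallNP H] :=
    pselect (exists x, forall y, prefix x y -> exists2 z, prefix y z & c z).
  have [t Ht] : exists t : node -> node, forall y, prefix x y ->
      prefix y (t y) /\ c (t y).
    have [|t Ht] := @choice _ _
        (fun y z => prefix x y -> prefix y z /\ c z); last by exists t.
    move=> y; have [/Hx[z yz cz]|] := boolP (prefix x y); first by exists z.
    by exists [::].
  pose fix f (w y : node) : node :=
    if y is b :: y' then f (rcons (t w) b) y' else t w.
  have step w b : prefix x w -> prefix x (rcons (t w) b).
    move=> xw; apply: prefix_trans (prefix_rcons _ _).
    exact: prefix_trans xw (Ht _ xw).1.
  have fw w y : prefix x w -> prefix w (f w y).
    elim: y w => [|b y IH] w xw /=; first exact: (Ht _ xw).1.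
    apply: prefix_trans (Ht _ xw).1 _; apply: prefix_trans (prefix_rcons _ b) _.
    by apply: IH; exact: step.
  have fE u w b y : prefix x w -> prefix (rcons u b) y ->
      prefix (rcons (f w u) b) (f w y).
    elim: u w y => [|b' u IH] w [|b'' y] //= xw.
      by rewrite prefix0s andbT => /eqP <-; apply: fw; exact: step.
    by case: eqP => //= <- /IH; apply; exact: step.
  have fc y w : prefix x w -> c (f w y).
    elim: y w => [|b y IH] w xw /=; first exact: (Ht _ xw).2.
    by apply: IH; exact: step.
  exists (f x); first by move=> u b y; apply: fE; exact: prefix_refl.
  by exists true => y; apply: fc; exact: prefix_refl.
have [y Hy] : exists y, forall z, prefix y z -> ~~ c z.
  have /existsNP[y /not_implyP[_ Hy]] := H [::].
  exists y => z yz; apply/negP => cz; apply: Hy; by exists z.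
exists (cat y); first exact: embedding_cat.
by exists false => x; apply/negbTE/Hy; exact: prefix_prefix.
Qed.

(** Induction on [d]. For a fixed lowest node, the induction hypothesis makes
    the colour of the rest of the chain constant in the cone on the side [b0].
    Doing this successively at all nodes, from the root upwards, gives an
    embedding [fus] for which the colour of a chain depends only on its lowest
    node, and [node_pigeonhole] finishes. *)
Lemma tree_ramsey d (c : seq node -> bool) :
  exists2 f, embedding f & exists b, forall l, chain d l -> c (map f l) = b.
Proof.
elim: d c => [|b0 d IH] c.
  have [f fE [b Hb]] := node_pigeonhole (fun x => c [:: x]).
  by exists f => //; exists b => -[|x []] //= _; exact: Hb.
have [h /all_and2[hE hP]] : exists h : (seq node -> bool) -> node -> node,
    forall c, embedding (h c) /\
    exists b, forall l, chain d l -> c (map (h c) l) = b.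
  have [|h Hh] := @choice _ _ (fun (c : seq node -> bool) f => embedding f /\
    exists b, forall l, chain d l -> c (map f l) = b); last by exists h.
  by move=> c'; have [f] := IH c'; exists f.
pose m (c : seq node -> bool) b :=
  if b == b0 then h (fun l => c ([::] :: map (cons b0) l)) else id.
have mE c' b : embedding (m c' b).
  by rewrite /m; case: ifP => _; [exact: hE|exact: embedding_id].
(* The recursion runs down the list and changes the colouring instead of the
   embedding: [fus c'] on the cone of side b is [m c' b] composed with [fus] for
   the colouring that c' induces there. *)
pose fix fus (c : seq node -> bool) (x : node) : node :=
  if x is b :: x'
  then b :: m c b (fus (fun l => c (map (cons b \o m c b) l)) x')
  else [::].
have fusE c' : embedding (fus c').
  move=> x; elim: x c' => [|b' x IHx] c' b [|b'' y]; rewrite /below //=.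
    by rewrite !prefix0s.
  by case: eqP => //= <- xy; apply: mE; exact: IHx.
have key x c' : exists b, forall l, chain (b0 :: d) (x :: l) ->
    c' (map (fus c') (x :: l)) = b.
  elim: x c' => [|b' x IHx] c'.
    have [b Hb] := hP (fun l => c' ([::] :: map (cons b0) l)).
    exists b => -[//|y l] /= /andP[]; rewrite /below; case: y => //= b1 y.
    case: eqP => // <- _ /chain_cons[l' -> H].
    pose c0 l := c' (map (cons b0 \o m c' b0) l).
    rewrite -(Hb (map (fus c0) (y :: l'))).
      rewrite /= -!map_comp; congr (c' [:: _, _ & _]).
        by rewrite /c0 /m eqxx.
      by apply: eq_map => z; rewrite /= /c0 /m eqxx.
    exact: chain_map.
  have [b Hb] := IHx (fun l => c' (map (cons b' \o m c' b') l)).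
  exists b => l /chain_cons[l' -> H]; rewrite -(Hb _ H) /=.
  by rewrite -!map_comp.
have [t Ht] := choice (fun x => key x c).
have [g gE [b Hb]] := node_pigeonhole t.
exists (fus c \o g); first exact: embedding_comp.
exists b => -[//|x l] /(chain_map gE) H.
by rewrite map_comp Ht.
Qed.

Definition increasing (h : nat -> nat) : Prop := {homo h : i j / i < j}.

(** Colour the chains of the tree by the levels of their nodes and take the
    levels of the leftmost branch of a homogeneous copy. *)
Lemma linear_ramsey n (c : seq nat -> bool) :
  exists2 h, increasing h & exists b, forall s, sorted ltn s -> size s = n ->
    c (map h s) = b.
Proof.
case: n => [|n]; first by exists id => //; exists (c [::]) => -[].
have [f fE [b Hb]] := tree_ramsey (nseq n false) (fun l => c (map size l)).
exists (fun i => size (f (nseq i false))).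
  move=> i j /(below_nseq false)/fE/size_prefix.
  by rewrite size_rcons.
exists b => s sS ss; rewrite -(Hb (map (fun i => nseq i false) s)).
  by rewrite -!map_comp.
elim: s n ss sS {Hb} => [//|i [|j s] IH] [|n] //= [ss] /andP[ij H].
by rewrite below_nseq // IH //= ss.
Qed.

End TreeRamsey.

(** * Blocks of a tree with consistent left chains *)

Lemma last_true (P : nat -> Prop) i k : P i -> ~ P k -> i <= k ->
  exists m, [/\ i <= m, P m & ~ P m.+1].
Proof.
move=> P0 Pk ik; apply: contrapT => H; apply: Pk.
rewrite -(subnKC ik); elim: (k - i) => [|m IH]; first by rewrite addn0.
rewrite addnS; apply: contrapT => Pm; apply: H; exists (i + m).
by rewrite leq_addr.
Qed.

Lemma chain_const b n x l :
  chain (nseq n b) (x :: l) = path (below b) x l && (size l == n).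
Proof.
elim: l x n => [|y l IH] x [|n] //=; first by rewrite andbF.
by rewrite IH andbA eqSS.
Qed.

(** In this section a node stands for an instance of a formula: the instances
    at the nodes of a left chain, each above its predecessor on the left side,
    are consistent together, and those of a right chain of [k] nodes are not.
    The conclusion is the combinatorial content of SOP1 for a conjunction of
    [n] instances. *)
Section TreeBlocks.
Variable Con : seq node -> Prop.
Hypothesis ConS : forall s s', {subset s' <= s} -> Con s -> Con s'.
Hypothesis Con0 : forall n l, chain (nseq n false) l -> Con l.
Variable k : nat.
Hypothesis k_gt0 : 0 < k.
Hypothesis Con1 : forall l, chain (nseq k.-1 true) l -> ~ Con l.

Definition right_then_left m n : seq bool := nseq m true ++ nseq n false.

Definition good m n f :=
  forall l, chain (right_then_left m n) l -> Con (map f l).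

Lemma chain_stem m d (x y : node) l :
  prefix (y ++ nseq m true) x -> chain d (x :: l) ->
  chain (nseq m true ++ d) ([seq y ++ nseq i true | i <- iota 0 m] ++ x :: l).
Proof.
elim: m y => [//|m IH] y yx xl.
have E : y ++ nseq m.+1 true = rcons y true ++ nseq m true by rewrite cat_rcons.
have yx' : below true y x.
  by rewrite /below; apply: prefix_trans yx; rewrite E prefix_prefix.
have := IH (rcons y true); rewrite -E => /(_ yx xl).
have -> : [seq y ++ nseq i true | i <- iota 0 m.+1] =
    y :: [seq rcons y true ++ nseq i true | i <- iota 0 m].
  rewrite /= cats0 -[1]/(1 + 0) iotaDl -map_comp; congr cons.
  by apply: eq_map => i /=; rewrite cat_rcons.
case: m {IH yx E} => [|m] /=; first by rewrite yx'.
by rewrite cats0 below_rcons.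
Qed.

(** The nodes of a block follow each other on the left side, and both places
    [next n y b] for the next block lie on the left side of all of them. The
    place [next n y false] is the right child of [next n y true], so that all
    blocks in the cone of the former lie above the first node of the block at
    the latter, on its right side. *)
Definition block n y : seq node := [seq y ++ nseq i false | i <- iota 0 n.+1].

Definition next n y (b : bool) : node :=
  y ++ nseq n.+1 false ++ (if b then [::] else [:: true]).
Definition stem m : seq node := [seq nseq i true | i <- iota 0 m].

Lemma blockS n y : block n.+1 y = y :: block n (rcons y false).
Proof.
rewrite /block.
have -> : iota 0 n.+2 = 0 :: map (addn 1) (iota 0 n.+1) by rewrite -iotaDl.
rewrite map_cons cats0 -map_comp.
by congr cons; apply: eq_map => i /=; rewrite cat_rcons.
Qed.

Lemma path_block n y z l :
  path (below false) z l ->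
  prefix (y ++ nseq n.+1 false) z ->
  path (below false) y
    (behead (block n y) ++ z :: l).
Proof.
move=> zl; elim: n y => [|n IH] y yz.
  by rewrite /= zl andbT /below -cats1.
have := IH (rcons y false); rewrite cat_rcons => /(_ yz).
by rewrite blockS; case: n {IH yz} => [|n] /=; rewrite ?cats0 below_rcons.
Qed.

Lemma chain_block n y : chain (nseq n false) (block n y).
Proof.
elim: n y => [|n IH] y; first by [].
rewrite blockS; have := IH (rcons y false).
by rewrite /block /= cats0 below_rcons.
Qed.

(** The union of the blocks met along [eta], which form a left chain. *)
Fixpoint branch n (y eta : node) : seq node :=
  block n y ++ (if eta is b :: eta' then branch n (next n y b) eta' else [::]).

Lemma branch_cons n y b eta :
  branch n y (b :: eta) = block n y ++ branch n (next n y b) eta.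
Proof. by []. Qed.

Lemma size_branch n y eta : size (branch n y eta) = (size eta).+1 * n.+1.
Proof.
elim: eta y => [|b eta IH] y.
  by rewrite /= cats0 size_map size_iota mul1n.
rewrite branch_cons size_cat IH size_map size_iota.
by rewrite [RHS]mulSn.
Qed.

Lemma branch_head n y eta : branch n y eta = y :: behead (branch n y eta).
Proof. by case: eta => [|b eta]; rewrite /= cats0. Qed.

Lemma chain_branch n y eta :
  chain (nseq ((size eta).+1 * n.+1).-1 false) (branch n y eta).
Proof.
rewrite branch_head chain_const size_behead size_branch eqxx andbT.
elim: eta y => [|b eta IH] y.
  have := chain_block n y; rewrite /= !cats0.
  by rewrite {1}/block /= cats0 chain_const => /andP[].
rewrite branch_cons branch_head.
rewrite -[behead _]/(behead (block n y) ++ _).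
apply: path_block; last by rewrite /next catA prefix_prefix.
by have := IH (next n y b); rewrite [X in behead X]branch_head.
Qed.

Arguments block : simpl never.

Lemma block_branch n y eta i :
  {subset block n (foldl (next n) y (take i eta)) <= branch n y eta}.
Proof.
have B y' e x : x \in block n y' -> x \in branch n y' e.
  by case: e => [|b e]; rewrite ?branch_cons mem_cat => ->.
elim: eta y i => [|b eta IH] y [|i] x; try exact: B.
rewrite branch_cons mem_cat => H.
by rewrite (IH _ i x H) orbT.
Qed.

Lemma next_prefix n y eta : prefix y (foldl (next n) y eta).
Proof.
elim: eta y => [|b eta IH] y /=; first exact: prefix_refl.
by apply: prefix_trans (IH _); rewrite prefix_prefix.
Qed.

(** Let [m] be maximal such that, for all [n], some copy of the tree has all
    its chains of type [1^m 0^n] consistent; it exists because [m = 0] has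
    this property and [m = k - 1] has not. For [m + 1] this fails for some
    [n0], so by [tree_ramsey] there is, for each [n], a copy with all chains
    of type [1^m 0^n] consistent and all chains of type [1^(m+1) 0^n0]
    inconsistent. Add the fixed stem [1^0, ..., 1^(m-1)] to each block of [n0
    + 1] nodes going left: the union of the blocks along a path has the first
    type, and the block at [eta 0 nu] together with the stem and the first
    node of the block at [eta 1] has the second. *)
Lemma tree_blocks : exists n, forall N, exists F : node -> seq node,
  [/\ forall eta, size (F eta) = n,
      forall eta, size eta = N ->
        Con (flatten [seq F (take i eta) | i <- iota 0 N.+1])
    & forall eta nu, ~ Con (F (rcons eta true) ++ F (rcons eta false ++ nu))].
Proof.
pose P m := forall n, exists2 f, embedding f & good m n f.
have P0 : P 0.
  by move=> n; exists id => // l /Con0; rewrite map_id.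
have Pk : ~ P k.-1.
  move=> /(_ 0)[f fE fgood].
  pose l := [seq nseq i true | i <- iota 0 k].
  have lc : chain (nseq k.-1 true) l.
    have := @chain_stem k.-1 [::] (nseq k.-1 true) [::] [::].
    rewrite cats0 prefix_refl => /(_ isT isT); congr chain.
    rewrite /l; have -> : iota 0 k = iota 0 k.-1 ++ [:: k.-1].
      by rewrite -{1}(prednK k_gt0) -addn1 iotaD.
    by rewrite map_cat.
  have := chain_map fE lc; move/Con1; apply; apply: fgood.
  by rewrite /right_then_left cats0.
have [m [_ Pm PSm]] := last_true P0 Pk (leq0n _).
have [n0 Hn0] : exists n, forall f, embedding f -> ~ good m.+1 n f.
  by move/existsNP: PSm => [n Hn]; exists n => f fE fg; apply: Hn; exists f.
exists (m + n0.+1) => N.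
have [f fE fgood] := Pm (N.+1 * n0.+1).-1.
have [g gE [b Hb]] :=
  tree_ramsey (right_then_left m.+1 n0) (fun l => `[< Con (map f l) >]).
have fgE := embedding_comp fE gE.
have bad l : chain (right_then_left m.+1 n0) l -> ~ Con (map (f \o g) l).
  move=> lc Cl; apply: (Hn0 _ fgE) => l' l'c.
  rewrite map_comp; apply/asboolP; rewrite (Hb _ l'c) -(Hb _ lc).
  by apply/asboolP; rewrite -map_comp.
have fggood : good m (N.+1 * n0.+1).-1 (f \o g).
  by move=> l /(chain_map gE)/fgood; rewrite -map_comp.
pose G := foldl (next n0) (nseq m true).
pose F eta := map (f \o g) (stem m ++ block n0 (G eta)).
exists F; split.
- by move=> eta; rewrite size_map size_cat !size_map !size_iota.
- move=> eta etaN.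
  have H : chain (right_then_left m (N.+1 * n0.+1).-1)
      (stem m ++ branch n0 (nseq m true) eta).
    rewrite /right_then_left branch_head.
    apply: (@chain_stem m _ _ [::]); first exact: prefix_refl.
    by rewrite -branch_head -etaN; exact: chain_branch.
  apply: ConS (fggood _ H) => x /flattenP[l /mapP[i _ ->] /mapP[y]].
  rewrite mem_cat => yl ->; apply: map_f; rewrite mem_cat.
  by case/orP: yl => [->//|/block_branch ->]; rewrite orbT.
move=> eta nu; set u := G (rcons eta true); set y := G (rcons eta false ++ nu).
have Gpre z : prefix (nseq m true) (G z) by exact: next_prefix.
have uy : below true u y.
  rewrite /below /y /G foldl_cat -/G; apply: prefix_trans (next_prefix _ _ _).
  rewrite /u /G !foldl_rcons /next cats0 -cats1 -catA; exact: prefix_refl.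
have H : chain (right_then_left m.+1 n0) (stem m ++ u :: block n0 y).
  rewrite /right_then_left -[m.+1]addn1 nseqD -catA.
  apply: (@chain_stem m _ _ [::]); first exact: Gpre.
  have := chain_block n0 y; rewrite /block /= cats0 => ->.
  by rewrite uy.
move=> C; apply: (bad _ H); apply: ConS C => x /mapP[z zl ->].
rewrite /F -map_cat; apply: map_f; move: zl.
rewrite !mem_cat inE => /or3P[->//|/eqP->|->]; last by rewrite !orbT.
by rewrite /block /= cats0 inE eqxx /= orbT.
Qed.

End TreeBlocks.

(** * Blocks of an array with consistent vertical paths *)

(** Here the indices are the cells of an array whose vertical paths are
    consistent and which has no [k] consistent cells in the same row. *)
Section ArrayBlocks.
Variable Con : seq (nat * nat) -> Prop.
Hypothesis ConS : forall s s', {subset s' <= s} -> Con s -> Con s'.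
Hypothesis Con_path : forall (eta : nat -> nat) R,
  Con [seq (r, eta r) | r <- iota 0 R].
Variable k : nat.
Hypothesis k_gt0 : 0 < k.
Hypothesis Con_row : forall r s, uniq s -> size s = k ->
  ~ Con [seq (r, j) | j <- s].

(** The cells in the rows [rho] obtained by giving to each row in turn the
    next [s] columns from [J]. As [J] is increasing, each row uses later
    columns than the rows before it: this is how [linear_ramsey] yields a
    Ramsey theorem for products. *)
Definition fill s (rho J : seq nat) : seq (nat * nat) :=
  zip (flatten [seq nseq s r | r <- rho]) J.

Definition homogeneous b s (rho : seq nat) (h : nat -> nat) :=
  forall J, sorted ltn J -> size J = s * size rho ->
    `[< Con (fill s rho (map h J)) >] = b.

Lemma homogeneous_comp b s rho h g : increasing g ->
  homogeneous b s rho h -> homogeneous b s rho (h \o g).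
Proof.
move=> gI H J sJ /esym J_size; rewrite map_comp; apply: H; rewrite ?size_map //.
by apply: homo_sorted sJ.
Qed.

Lemma homogeneous_all s (rhos : seq (seq nat)) h :
  exists2 g, increasing g & forall rho, rho \in rhos ->
    exists b, homogeneous b s rho (h \o g).
Proof.
elim: rhos => [|rho rhos [g gI IH]]; first by exists id.
have [g' g'I [b Hb]] := linear_ramsey (s * size rho)
   (fun J => `[< Con (fill s rho (map (h \o g) J)) >]).
exists (g \o g') => [i j ij|rho']; first exact/gI/g'I.
rewrite inE => /predU1P[->|/IH[b' Hb']].
  by exists b => J sJ /(Hb _ sJ) <-; rewrite -map_comp.
exists b'; exact: homogeneous_comp g'I Hb'.
Qed.

(** The columns are cut into windows of width [W], the [g]-th of which serves
    the row of rank [g]; the columns of a row then precede those of later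
    rows. *)
Definition cells W (rho H : nat -> nat) (C : nat -> seq nat) (l : seq nat) :=
  flatten [seq [seq (rho g, H (g * W + c)) | c <- C g] | g <- l].

Lemma cells_fill s W rho H C l : (forall g, g \in l -> size (C g) = s) ->
  cells W rho H C l = fill s (map rho l)
    (map H (flatten [seq [seq g * W + c | c <- C g] | g <- l])).
Proof.
elim: l => [//|g l IH] sC.
rewrite /cells /= -/(cells _ _ _ _ _) IH => [|g' g'l]; last first.
  by apply: sC; rewrite inE g'l orbT.
rewrite /fill /= map_cat zip_cat; last first.
  by rewrite size_nseq !size_map sC ?mem_head.
congr cat; rewrite -map_comp.
have <- : size (C g) = s by apply: sC; rewrite mem_head.
by elim: (C g) => //= c cs ->.
Qed.

Lemma sorted_cells W C l : sorted ltn l ->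
  (forall g, g \in l -> sorted ltn (C g) /\ all (gtn W) (C g)) ->
  sorted ltn (flatten [seq [seq g * W + c | c <- C g] | g <- l]).
Proof.
rewrite !(sorted_pairwise ltn_trans); elim: l => [//|g l IH] /= /andP[gl sl] HC.
rewrite pairwise_cat IH // => [|g' g'l]; last first.
  by apply: HC; rewrite inE g'l orbT.
have [sC CW] := HC g (mem_head _ _).
rewrite andbT; apply/andP; split; last first.
  rewrite pairwise_map; move: sC; rewrite (sorted_pairwise ltn_trans).
  by apply: sub_pairwise => x y; rewrite /= ltn_add2l.
apply/allrelP => x y /mapP[c cC ->] /flattenP[_ /mapP[g' g'l ->]].
case/mapP=> c' _ ->.
have := allP gl _ g'l; have := allP CW _ cC; rewrite /=; nia.
Qed.

Lemma size_flatten_const (T : Type) s (f : nat -> seq T) l :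
  (forall g, g \in l -> size (f g) = s) ->
  size (flatten [seq f g | g <- l]) = s * size l.
Proof.
elim: l => [|g l IH] fs /=; first by rewrite muln0.
rewrite size_cat fs ?mem_head // IH ?mulnS // => g' g'l.
by apply: fs; rewrite inE g'l orbT.
Qed.

(** Let [s] be maximal such that, for all [R], there are [R] rows and
    infinitely many columns for which every choice of [s] cells in each row,
    in the sense of [fill], is consistent; it exists because [s = 1] has this
    property and [s = k] has not. For [s + 1] it fails for some number [R0] of
    rows, so by Ramsey's theorem the columns can be thinned out until every
    choice of [s + 1] cells in each row of a group of [R0] rows is
    inconsistent. The block at [(i, j)] consists of the first [s - 1] cells
    and the [j]-th later one, within the window of the row, for each row of
    the [i]-th group: along a vertical path there are [s] cells in each row,
    and two blocks of the same group contain [s + 1] cells in each of [R0]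
    rows. *)
Lemma array_blocks : exists n, forall N,
  exists F : nat * nat -> seq (nat * nat),
  [/\ forall x, size (F x) = n,
      forall eta : nat -> nat, (forall i, i < N -> eta i < N) ->
        Con (flatten [seq F (i, eta i) | i <- iota 0 N])
    & forall i j l, i < N -> j < N -> l < N -> j <> l ->
        ~ Con (F (i, j) ++ F (i, l))].
Proof.
pose P s := forall R, exists rho h,
  [/\ size rho = R, increasing h & homogeneous true s rho h].
have P1 : P 1.
  move=> R; exists (iota 0 R), id; split=> //; first by rewrite size_iota.
  move=> J _; rewrite mul1n size_iota map_id => JR; apply/asboolP.
  have := Con_path (nth 0 J) R; congr Con; rewrite /fill.
  have -> : flatten [seq nseq 1 r | r <- iota 0 R] = iota 0 R.
    by elim: (iota 0 R) => //= r l ->.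
  apply: (@eq_from_nth _ (0, 0)).
    by rewrite size_map size_zip size_iota JR minnn.
  rewrite size_map size_iota => i iR.
  by rewrite nth_zip ?size_iota // (nth_map 0) ?size_iota // nth_iota.
have Pk : ~ P k.
  move=> /(_ 1)[rho [h []]]; case: rho => [|r []] // _ hI.
  move/(_ (iota 0 k) (iota_ltn_sorted _ _)); rewrite size_iota muln1.
  move=> /(_ erefl)/asboolP; rewrite /fill /= cats0.
  have -> : zip (nseq k r) (map h (iota 0 k)) =
      [seq (r, j) | j <- map h (iota 0 k)].
    by rewrite -{1}(size_iota 0 k); elim: (iota 0 k) => //= i l ->.
  apply: Con_row; last by rewrite size_map size_iota.
  rewrite map_inj_uniq ?iota_uniq // => i j hij.
  by case: (ltngtP i j) => // /hI; rewrite hij ltnn.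
have [s [s_gt0 Ps PSs]] := last_true P1 Pk k_gt0.
have [R0 HR0] : exists R, forall rho h, size rho = R -> increasing h ->
    ~ homogeneous true s.+1 rho h.
  move/existsNP: PSs => [R HR]; exists R => rho h rR hI hH; apply: HR.
  by exists rho, h.
exists (R0 * s) => N.
have [rho [h [rhoR hI hgood]]] := Ps (N * R0).
pose group i := iota (i * R0) R0.
have [g gI Hg] := homogeneous_all s.+1
  [seq map (nth 0 rho) (group i) | i <- iota 0 N] h.
pose H := h \o g.
have HI : increasing H by move=> i j /gI/hI.
have Hgood : homogeneous true s rho H by exact: homogeneous_comp.
have Hbad i : i < N -> homogeneous false s.+1 (map (nth 0 rho) (group i)) H.
  move=> iN; have [|[] //] := Hg (map (nth 0 rho) (group i)).
    by apply: map_f; rewrite mem_iota.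
  by move=> /HR0; rewrite size_map size_iota => /(_ erefl HI).
pose W := s + N.
pose C j := rcons (iota 0 s.-1) (s.-1 + j).
pose F (x : nat * nat) := cells W (nth 0 rho) H (fun=> C x.2) (group x.1).
have sizeC j : size (C j) = s by rewrite size_rcons size_iota prednK.
have ltC j : j < N -> all (gtn W) (C j).
  move=> jN; rewrite all_rcons; apply/andP; split; first by rewrite /W /=; lia.
  by apply/allP => c; rewrite mem_iota /W /=; lia.
have sorted_extend t x :
    sorted ltn t -> all (gtn x) t -> sorted ltn (rcons t x).
  by rewrite !(sorted_pairwise ltn_trans) pairwise_rcons => -> ->.
have sortedC j : sorted ltn (C j).
  apply: sorted_extend; first exact: iota_ltn_sorted.
  by apply/allP => c; rewrite mem_iota /=; lia.
exists F; split.
- move=> [i j]; rewrite /F /cells (@size_flatten_const _ s) => [|r _].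
    by rewrite size_iota mulnC.
  by rewrite size_map sizeC.
- move=> eta etaN.
  have -> : flatten [seq F (i, eta i) | i <- iota 0 N] =
      cells W (nth 0 rho) H (fun g => C (eta (g %/ R0))) (iota 0 (N * R0)).
    move: {1 2}N => n; elim: n => [//|n IH].
    rewrite -addn1 iotaD map_cat flatten_cat IH mulnDl mul1n iotaD /cells.
    rewrite [in RHS]map_cat flatten_cat; congr cat; rewrite /= cats0.
    congr flatten; apply/eq_in_map => r.
    rewrite mem_iota /= add0n => /andP[rl rr].
    congr map; congr (C (eta _)).
    have R0_gt0 : 0 < R0 by lia.
    rewrite -(subnKC rl) divnMDl // divn_small; lia.
  rewrite (@cells_fill s) //.
  have -> : [seq nth 0 rho i | i <- iota 0 (N * R0)] = rho.
    by rewrite -rhoR; exact: mkseq_nth.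
  apply/asboolP/Hgood; last first.
    rewrite (@size_flatten_const _ s) => [|r _].
      by rewrite size_iota rhoR.
    by rewrite size_map sizeC.
  apply: sorted_cells => [|r]; first exact: iota_ltn_sorted.
  rewrite mem_iota => /= rN.
  have R0_gt0 : 0 < R0 by case: (R0) rN; rewrite ?muln0.
  by split; [exact: sortedC|apply: ltC; apply: etaN; rewrite ltn_divLR].
- have bad i j l : i < N -> j < l -> l < N -> ~ Con (F (i, j) ++ F (i, l)).
    move=> iN jl lN CF.
    pose C' := rcons (C j) (s.-1 + l).
    suff : Con (cells W (nth 0 rho) H (fun=> C') (group i)).
      rewrite (@cells_fill s.+1) => [|r _]; last by rewrite size_rcons sizeC.
      move/asboolP; rewrite Hbad //.
        apply: sorted_cells => [|r _]; first exact: iota_ltn_sorted.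
        split; last by rewrite all_rcons ltC ?(ltn_trans jl) // andbT /=; lia.
        apply: sorted_extend => //; rewrite all_rcons /= ltn_add2l jl /=.
        by apply/allP => c; rewrite mem_iota /=; lia.
      rewrite (@size_flatten_const _ s.+1) => [|r _]; first by rewrite size_map.
      by rewrite size_map size_rcons sizeC.
    apply: ConS CF => x /flattenP[_ /mapP[r ri ->] /mapP[c cC ->]].
    rewrite mem_cat; apply/orP.
    have cF j' : c \in C j' -> (nth 0 rho r, H (r * W + c)) \in F (i, j').
      move=> cj; apply/flattenP.
      exists [seq (nth 0 rho r, H (r * W + c)) | c <- C j'].
        by apply/mapP; exists r.
      by apply/mapP; exists c.
    move: cC; rewrite mem_rcons inE => /predU1P[cl|/cF]; last by left.
    by right; apply: cF; rewrite cl mem_rcons mem_head.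
  move=> i j l iN jN lN; case: (ltngtP j l) => // jl _; first exact: bad.
  move=> CF; apply: (bad i l j) => //; apply: ConS CF => x.
  by rewrite !mem_cat orbC.
Qed.

End ArrayBlocks.

(** * Descending combs *)

Section Combs.

Lemma split_at m x y : below false m x -> below true m y ->
  [/\ meet x y = m, incomparable x y, incomparable y x & lex_lt x y].
Proof.
move=> /prefixP[x' ->] /prefixP[y' ->]; rewrite !cat_rcons.
have M : meet (m ++ false :: x') (m ++ true :: y') = m.
  by elim: m => //= b m ->; rewrite eqxx.
have I : incomparable (m ++ false :: x') (m ++ true :: y').
  by rewrite /incomparable !prefix_catr // !eqxx.
split=> //; first by rewrite /incomparable andbC.
by rewrite /lex_lt I M !nth_cat ltnn subnn /= orbT.
Qed.

(** The node [mu j] is the place where the tooth [eta j] branches off to the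
    right from the spine; the later the tooth, the lower that place. *)
Lemma descending_combP n (mu eta : 'I_n.+1 -> node) :
  (forall i j : 'I_n.+1, i < j -> below false (mu j) (eta i)) ->
  (forall j, below true (mu j) (eta j)) ->
  descending_comb (range eta).
Proof.
move=> Hf Ht.
have H (i j : 'I_n.+1) (ij : i < j) := split_at (Hf i j ij) (Ht j).
exists n, eta; split=> //.
- move=> _ _ [i _ <-] [j _ <-] ne.
  case: (ltngtP i j) => [ij|ji|/val_inj ij]; first by have [] := H _ _ ij.
    by have [] := H _ _ ji.
  by rewrite ij in ne.
- by move=> i j /H[].
- move=> i j k ij jk; have [-> _ _ _] := H _ _ jk.
  by have [-> _ _ _] := H _ _ (ltn_trans ij jk).
Qed.

End Combs.

(** * From combs and paths to TP2 and SOP1 *)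

Section FromDCTP2.
Variables (L : language) (K : Type) (M : structure L).
Hypothesis hK : card_lt [set: formula L nat] K.
Hypothesis hS : saturated K M.
Variables (p q : nat) (phi : formula L ('I_p + 'I_q)) (k : nat).
Hypothesis k_gt0 : 0 < k.
Variable a : node -> 'I_q -> M.
Hypothesis a_comb : forall X, descending_comb X -> consistent phi (a @` X).
Hypothesis a_path :
  forall eta : nat -> bool, k_inconsistent k phi (fun i => a (mkseq eta i)).

Lemma realized_comb n (mu eta : 'I_n.+1 -> node) (I : eqType) (f : I -> node)
    (s : seq I) :
  (forall i j : 'I_n.+1, i < j -> below false (mu j) (eta i)) ->
  (forall j, below true (mu j) (eta j)) ->
  (forall i, i \in s -> exists j, f i = eta j) ->
  realized phi (a \o f) s.
Proof.
move=> Hf Ht sub.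
apply: (consistent_realized (a_comb (descending_combP Hf Ht))) => i /sub[j ij].
by exists (f i) => //; exists j.
Qed.

Lemma not_realized_path (eta : nat -> bool) (I : eqType) (f : I -> node)
    (s : seq I) :
  size s = k -> (forall i, i \in s -> f i = mkseq eta (size (f i))) ->
  uniq [seq size (f i) | i <- s] -> ~ realized phi (a \o f) s.
Proof.
move=> sk sf su /realized_consistent H.
apply: (a_path (eta := eta) su); first by rewrite size_map.
by apply: H => _ [_ /mapP[i si ->] <-]; exists i; rewrite //= -sf.
Qed.

Lemma blocks_formula n : exists q' (psi : formula L ('I_p + 'I_q')),
  forall (I J : eqType) (b : J -> 'I_q -> M) (F : I -> seq J),
  (forall x, size (F x) = n) -> exists b' : I -> 'I_q' -> M,
  forall s, realized psi b' s <-> realized phi b (flatten [seq F x | x <- s]).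
Proof.
have [q' [psi Hpsi]] := conj_formula phi n.
have [B HB] := Hpsi M; exists q', psi => I J b F sF.
have sFb x : size (F x) == n by apply/eqP.
exists (fun x => B (fun i => b (tnth (Tuple (sFb x)) i))) => s.
split=> -[c Hc]; exists c => x.
  move=> /flattenP[_ /mapP[y ys ->]] xy.
  have /tnthP[i ->] : x \in Tuple (sFb y) by [].
  by move: i; apply/HB; exact: Hc.
move=> xs; apply/HB => i; apply: Hc; apply/flattenP; exists (F x).
  exact: map_f.
exact: (mem_tnth i (Tuple (sFb x))).
Qed.

Lemma realized_map p' q' (psi : formula L ('I_p' + 'I_q')) (I J : eqType)
    (f : I -> J) (b : J -> 'I_q' -> M) s :
  realized psi b (map f s) -> realized psi (b \o f) s.
Proof. by case=> c Hc; exists c => i si; apply: Hc; exact: map_f. Qed.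

(** The node [0^i 1 0^j] is put in the cell [(i, j)]: the nodes of a row lie
    on a path, and choosing one node in each of finitely many rows gives a
    comb. *)
Lemma TP2_of_DCTP2 : has_TP2 M.
Proof.
pose f (x : nat * nat) : node := nseq x.1 false ++ true :: nseq x.2 false.
have [||n Hn] := @array_blocks (realized phi (a \o f))
  (@realized_sub _ _ _ phi M _ (a \o f)) _ k k_gt0 _.
- move=> eta R.
  apply: (@realized_comb R (fun j => nseq (R - j) false)
    (fun j => f (R - j, eta (R - j)))).
  + move=> i j ij; apply: prefix_trans (prefix_prefix _ _).
    apply: below_nseq; apply: ltn_sub2l (ij); exact: leq_trans ij (ltn_ord j).
  + by move=> j; rewrite /below /f -cat_rcons prefix_prefix.
  + move=> x /mapP[r]; rewrite mem_iota => /= rR ->.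
    by exists (inord (R - r)); rewrite inordK ?subKn //; lia.
- move=> r s us sk.
  apply: (@not_realized_path (fun i => i == r)); first by rewrite size_map.
    move=> _ /mapP[j _ ->]; apply: (@eq_from_nth _ false).
      by rewrite size_mkseq.
    move=> i ilt; rewrite nth_mkseq // /f /= nth_cat size_nseq nth_nseq.
    case: ltngtP => [//|ri|->]; last by rewrite subnn.
    by rewrite -(subnKC ri) addSn -addnS addKn /= nth_nseq; case: ifP.
  rewrite -map_comp map_inj_uniq // => i j /=.
  by rewrite !size_cat /= !size_nseq => /addnI[].
have [q' [psi Hpsi]] := blocks_formula n.
have [D|b [bPos bNeg]] := @realized_compactness _ _ _ hK hS _ _ psi _
  [set s | exists (eta : nat -> nat) R, s = [seq (i, eta i) | i <- iota 0 R]]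
  [set s | exists i j l, j <> l /\ s = [:: (i, j); (i, l)]].
  pose N := (\max_(x <- D) maxn x.1 x.2).+1.
  have DN i j : (i, j) \in D -> i < N /\ j < N.
    move=> ijD; rewrite !ltnS.
    have := @leq_bigmax_seq _ D xpredT (fun x => maxn x.1 x.2) _ ijD isT.
    by rewrite geq_max => /andP.
  have [F [sF FP FN]] := Hn N.
  have [b Hb] := Hpsi _ _ (a \o f) F sF; exists b; split.
    move=> _ [eta [R ->]] sub; apply/Hb.
    have etaN i : i < R -> i < N /\ eta i < N.
      by move=> iR; apply/DN/sub/map_f; rewrite mem_iota.
    pose eta' i := if i < R then eta i else 0.
    have := FP eta'; have H i : i < N -> eta' i < N.
      by move=> iN; rewrite /eta'; case: ifP => // /etaN[].
    move=> /(_ H); apply: realized_sub => x.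
    move=> /flattenP[_ /mapP[_ /mapP[i + ->] ->]].
    rewrite mem_iota => /andP[_ iR] xF; apply/flattenP.
    exists (F (i, eta i)) => //.
    apply/mapP; exists i; last by rewrite /eta' iR.
    by rewrite mem_iota; case: (etaN i iR).
  move=> _ [i [j [l [jl ->]]]] sub /Hb; rewrite /= cats0.
  have [iN jN] : i < N /\ j < N by apply/DN/sub; rewrite mem_head.
  have [_ lN] : i < N /\ l < N by apply/DN/sub; rewrite !inE eqxx orbT.
  exact: FN.
exists p, q', psi, (fun i j => b (i, j)); split.
  move=> eta; apply: (realized_range hK hS) => R.
  apply: (realized_map (f := fun i => (i, eta i))).
  by apply: bPos; exists eta, R.
move=> i j l jl C; apply: (bNeg [:: (i, j); (i, l)]); first by exists i, j, l.
apply: (consistent_realized C) => x.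
by rewrite !inE => /orP[]/eqP->; [left|right].
Qed.

(** The node [x] stands for the instance at [x 1]. For a left chain these form
    a comb whose spine runs through the chain, and for a right chain they are
    pairwise comparable. *)
Lemma SOP1_of_DCTP2 : has_SOP1 M.
Proof.
pose f (x : node) : node := rcons x true.
have [||n Hn] := @tree_blocks (realized phi (a \o f))
  (@realized_sub _ _ _ phi M _ (a \o f)) _ k k_gt0 _.
- move=> R; case=> [|y l]; first by case: R.
  rewrite chain_const => /andP[yl /eqP lR].
  pose u i := nth [::] (y :: l) i.
  apply: (@realized_comb R (fun j => u (R - j)) (fun j => f (u (R - j)))).
  + move=> i j ij; apply: (@prefix_trans _ (u (R - i))); last first.
      exact: prefix_rcons.
    apply: (sorted_ltn_nth (@below_trans false) [::]
      (yl : sorted _ (y :: l)) (R - j) (R - i)).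
    - by rewrite inE /= lR ltnS leq_subr.
    - by rewrite inE /= lR ltnS leq_subr.
    - by apply: ltn_sub2l (ij); exact: leq_trans ij (ltn_ord j).
  + by move=> j; rewrite /below prefix_refl.
  + move=> x xl; have := xl; rewrite -index_mem /= lR ltnS => iR.
    exists (inord (R - index x (y :: l))).
    by rewrite inordK ?ltnS ?leq_subr // subKn // /u nth_index.
- case=> [|y l]; first by case: (k.-1).
  rewrite chain_const => /andP[yl /eqP lk].
  pose z := f (last y l).
  apply: (@not_realized_path (nth false z)); first by rewrite /= lk prednK.
    move=> x xl; have xz : prefix (f x) z.
      have : x = last y l \/ below true x (last y l).
        elim: l x y yl {z lk} xl => [|w l IH] x y /= => [_|/andP[yw wl]].
          by rewrite inE => /eqP ->; left.
        rewrite inE => /predU1P[->|xl]; last exact: IH.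
        right; have [<- //|] := IH w w wl (mem_head _ _).
        exact: below_trans.
      case=> [->|xz]; first exact: prefix_refl.
      exact: prefix_trans xz (prefix_rcons _ _).
    case/prefixP: xz => w ->; apply: (@eq_from_nth _ false).
      by rewrite size_mkseq.
    by move=> i ilt; rewrite nth_mkseq // nth_cat ilt.
  apply: sorted_uniq ltn_trans ltnn _ _.
  have : sorted (below true) (y :: l) by [].
  apply: homo_sorted => x w /size_prefix.
  by rewrite !size_rcons.
have [q' [psi Hpsi]] := blocks_formula n.
have [D|b [bPos bNeg]] := @realized_compactness _ _ _ hK hS _ _ psi _
  [set s | exists (eta : nat -> bool) R, s = [seq mkseq eta i | i <- iota 0 R]]
  [set s | exists eta nu : node,
    s = [:: rcons eta true; rcons eta false ++ nu]].
  pose N := \max_(x <- D) size x.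
  have DN x : x \in D -> size x <= N.
    by move=> xD; exact: (@leq_bigmax_seq _ D xpredT size _ xD isT).
  have [F [sF FP FN]] := Hn N.
  have [b Hb] := Hpsi _ _ (a \o f) F sF; exists b; split.
    move=> _ [eta [R ->]] sub; apply/Hb.
    have := FP (mkseq eta N) (size_mkseq _ _).
    apply: realized_sub => x /flattenP[_ /mapP[_ /mapP[i iR ->] ->]] xF.
    have iN : i <= N by rewrite -(size_mkseq eta i); apply/DN/sub/map_f.
    apply/flattenP; exists (F (mkseq eta i)) => //; apply/mapP; exists i.
      by rewrite mem_iota ltnS.
    by rewrite /mkseq -map_take take_iota (minn_idPl iN).
  by move=> _ [eta [nu ->]] sub /Hb; rewrite /= cats0; exact: FN.
exists p, q', psi, b; split.
  move=> eta; apply: (realized_range hK hS) => R.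
  apply: (realized_map (f := mkseq eta)).
  by apply: bPos; exists eta, R.
move=> eta nu C; apply: (bNeg [:: rcons eta true; rcons eta false ++ nu]).
  by exists eta, nu.
apply: (consistent_realized C) => x.
by rewrite !inE => /orP[]/eqP->; [left|right].
Qed.

End FromDCTP2.

(** * The implications between the dividing lines *)

Lemma consistent_sub (L : language) (M : structure L) p q
    (phi : formula L ('I_p + 'I_q)) (B B' : set ('I_q -> M)) :
  B' `<=` B -> consistent phi B -> consistent phi B'.
Proof.
by move=> sB [N [f [c [fE Hc]]]]; exists N, f, c; split=> // b /sB /Hc.
Qed.

Lemma DCTP2_of_ATP (L : language) (M : structure L) k :
  2 <= k -> has_ATP M -> has_DCTP2 M k.
Proof.
move=> k_ge2 [p [q [phi [a [a_anti a_pair]]]]]; exists p, q, phi, a.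
split=> [X [n [eta [_ aX _ _]]]|eta]; first exact: a_anti.
have mono i j : i <= j -> prefix (mkseq eta i) (mkseq eta j).
  by move=> /subnKC <-; rewrite /mkseq iotaD map_cat prefix_prefix.
have pair i j : i < j ->
    ~ consistent phi [set a (mkseq eta i); a (mkseq eta j)].
  move=> ij; apply: a_pair; first exact: mono (ltnW ij).
  by move/(congr1 size); rewrite !size_mkseq => ijE; rewrite ijE ltnn in ij.
move=> [|i [|j s]] /=; try by move=> _ sk; rewrite -sk in k_ge2.
rewrite inE negb_or => /andP[/andP[ij _] _] _ C.
have {}C : consistent phi [set a (mkseq eta i); a (mkseq eta j)].
  apply: consistent_sub C => _ [->|->]; [exists i|exists j] => //=;
    by rewrite !inE eqxx ?orbT.
case: (ltngtP i j) ij => // ij _; first exact: pair ij C.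
by apply: (pair _ _ ij); rewrite setUC.
Qed.

Lemma DCTP2S (L : language) (M : structure L) k :
  has_DCTP2 M k -> has_DCTP2 M k.+1.
Proof.
move=> [p [q [phi [a [a_comb a_path]]]]]; exists p, q, phi, a; split=> // eta.
case=> [//|i s] /= /andP[_ us] [sk] C; apply: (a_path eta s us sk).
apply: consistent_sub C => _ [j js <-]; exists j => //=.
by move: js => /= js; rewrite inE js orbT.
Qed.

Theorem mainTheorem6 (k : nat) (L : language) (T : set (sentence L))
    (K : Type) (M : structure L)
    (hk : 2 <= k) (hT : complete_theory T) (hM : monster K T M) :
  [/\ has_DCTP2 M k -> has_TP2 M,
      has_DCTP2 M k -> has_SOP1 M,
      has_ATP M -> has_DCTP2 M k
    & has_DCTP2 M k -> has_DCTP2 M k.+1].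
Proof.
have [_ hK hS _] := hM; have k_gt0 : 0 < k by exact: ltnW.
split.
- move=> [p [q [phi [a [a_comb a_path]]]]].
  exact: (TP2_of_DCTP2 hK hS k_gt0 a_comb a_path).
- move=> [p [q [phi [a [a_comb a_path]]]]].
  exact: (SOP1_of_DCTP2 hK hS k_gt0 a_comb a_path).
- exact: DCTP2_of_ATP.
- exact: DCTP2S.
Qed.
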